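(* Let $F_1,F_2$ be two distinct points in the Euclidean plane and let $O$ be the midpoint of the segment $F_1F_2$. The lemniscate of Bernoulli with foci $F_1$ and $F_2$ is the image of the equilateral hyperbola with foci $F_1$ and $F_2$ under inversion with respect to the circle with center $O$ and radius $|OF_1|$; that is, this inversion maps the hyperbola onto the lemniscate with the point $O$ removed (the point $O$ corresponding to the point at infinity).
   Context: The lemniscate of Bernoulli with foci $F_1\neq F_2$ is the set of points $X$ of the plane such that $|F_1X|\cdot|F_2X|=\frac14|F_1F_2|^2$. The equilateral (rectangular) hyperbola with foci $F_1$ and $F_2$ is the set of points $X$ such that $\big||F_1X|-|F_2X|\big|=\frac{|F_1F_2|}{\sqrt2}$. Inversion with respect to the circle with center $O$ and radius $r$ maps every point $X\neq O$ of the plane to the point $X^*$ on the ray $OX$ such that $|OX^*|=\frac{r^2}{|OX|}$. *)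

(* Defs.v *)
From mathcomp Require Import all_boot all_order all_algebra.
From mathcomp Require Import boolp classical_sets reals.
Set Implicit Arguments.
Unset Strict Implicit.
Unset Printing Implicit Defensive.
Import Order.TTheory GRing.Theory Num.Theory.
Local Open Scope classical_set_scope.
Local Open Scope ring_scope.

(* The Euclidean plane is 'rV[R]_2 with the distance edist; the norm that
   MathComp-Analysis puts on row vectors is the sup norm. *)
Definition edist (R : realType) (X Y : 'rV[R]_2) : R :=
  Num.sqrt (\sum_(i < 2) (X 0 i - Y 0 i) ^+ 2).

Definition emidpoint (R : realType) (X Y : 'rV[R]_2) : 'rV[R]_2 :=
  2^-1 *: (X + Y).

Definition eray (R : realType) (O X : 'rV[R]_2) : set 'rV[R]_2 :=
  [set O + t *: (X - O) | t in [set t : R | 0 <= t]].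

Definition lemniscate (R : realType) (F1 F2 : 'rV[R]_2) : set 'rV[R]_2 :=
  [set X | edist F1 X * edist F2 X = 4^-1 * edist F1 F2 ^+ 2].

Definition equilateral_hyperbola (R : realType) (F1 F2 : 'rV[R]_2) :
    set 'rV[R]_2 :=
  [set X | `|edist F1 X - edist F2 X| = edist F1 F2 / Num.sqrt 2].

(* Graph of the partial map X |-> X^*, which is undefined at X = O. *)
Definition inversion (R : realType) (O : 'rV[R]_2) (r : R)
    (X Y : 'rV[R]_2) : Prop :=
  [/\ X <> O, eray O X Y & edist O Y = r ^+ 2 / edist O X].

(* Inversion on the plane extended by a point at infinity, encoded as None:
   it exchanges O and None. *)
Definition ext_inversion (R : realType) (O : 'rV[R]_2) (r : R)
    (X Y : option 'rV[R]_2) : Prop :=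
  match X, Y with
  | Some X', Some Y' => inversion O r X' Y'
  | Some X', None => X' = O
  | None, Some Y' => Y' = O
  | None, None => False
  end.

Definition rel_image (T U : Type) (f : T -> U -> Prop) (A : set T) : set U :=
  [set y | exists2 x, A x & f x y].

(* Main.v *)
Require Import Defs.
From mathcomp Require Import all_boot all_order all_algebra.
From mathcomp Require Import boolp classical_sets reals.
From mathcomp Require Import ring lra.
Import Order.TTheory GRing.Theory Num.Theory.
Local Open Scope classical_set_scope.
Local Open Scope ring_scope.

(** Take [O] as the origin, so that the foci are [f] and [- f], and put
    [c = |f|^2], [N = |x|^2] and [p = <x, f>].  The squared distances from [x]
    to the foci are [N + c - 2 p] and [N + c + 2 p], hence the square of the
    product of the distances is [(N + c)^2 - 4 p^2].  The lemniscate asks for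
    this product to be [c]; squaring the equation of the hyperbola asks for it
    to be [N].  Thus the two curves are
      - lemniscate: [N^2 + 2 c N = 4 p^2]   ([lemniscateP]),
      - hyperbola:  [c^2 + 2 c N = 4 p^2]   ([hyperbolaP]).
    The inversion is [x |-> (c / N) x] ([inversionP]); it replaces [N] by
    [c^2 / N] and [p] by [c p / N], which turns the first equation into the
    second one multiplied by [c^2 / N^2] ([lemniscate_inversion]).  As the
    inversion is an involution of the punctured plane ([inversion_sym],
    [inversion_total]), the image of the hyperbola is the whole lemniscate
    without [O].  Finally [O] satisfies the first equation but not the second,
    so in the extended plane [O] is reached from infinity and nothing is sent to
    infinity. *)

Definition dot {R : realType} (u v : 'rV[R]_2) : R :=
  \sum_(i < 2) u 0 i * v 0 i.

Lemma dot_self {R : realType} (u : 'rV[R]_2) :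
  dot u u = \sum_(i < 2) u 0 i ^+ 2.
Proof. by apply: eq_bigr => i _; rewrite expr2. Qed.

Lemma dot_ge0 {R : realType} (u : 'rV[R]_2) : 0 <= dot u u.
Proof. by rewrite dot_self sumr_ge0 // => i _; rewrite sqr_ge0. Qed.

Lemma dot_eq0 {R : realType} (u : 'rV[R]_2) : (dot u u == 0) = (u == 0).
Proof.
rewrite dot_self psumr_eq0; last by move=> i _; rewrite sqr_ge0.
apply/allP/eqP => [u0|-> i _]; last by rewrite mxE expr0n eqxx.
apply/rowP => i; rewrite mxE; apply/eqP; rewrite -sqrf_eq0.
exact: (u0 i (mem_index_enum i)).
Qed.

Lemma dotZl {R : realType} (a : R) (u v : 'rV[R]_2) :
  dot (a *: u) v = a * dot u v.
Proof. by rewrite mulr_sumr; apply: eq_bigr => i _; rewrite mxE mulrA. Qed.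

Lemma dotZZ {R : realType} (a : R) (u : 'rV[R]_2) :
  dot (a *: u) (a *: u) = a ^+ 2 * dot u u.
Proof. by rewrite mulr_sumr; apply: eq_bigr => i _; rewrite mxE; ring. Qed.

Lemma edistE {R : realType} (X Y : 'rV[R]_2) :
  edist X Y = Num.sqrt (dot (X - Y) (X - Y)).
Proof.
by rewrite dot_self; congr Num.sqrt; apply: eq_bigr => i _; rewrite !mxE.
Qed.

Lemma edist_ge0 {R : realType} (X Y : 'rV[R]_2) : 0 <= edist X Y.
Proof. exact: sqrtr_ge0. Qed.

Lemma sqr_edist {R : realType} (X Y : 'rV[R]_2) :
  edist X Y ^+ 2 = dot (X - Y) (X - Y).
Proof. by rewrite edistE sqr_sqrtr ?dot_ge0. Qed.

Lemma edistO {R : realType} (O x : 'rV[R]_2) :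
  edist O (O + x) = Num.sqrt (dot x x).
Proof.
by rewrite edistE opprD addNKr -scaleN1r dotZZ sqrrN expr1n mul1r.
Qed.

Lemma eqr_sqr_ge0 {R : realType} (a b : R) :
  0 <= a -> 0 <= b -> a = b <-> a ^+ 2 = b ^+ 2.
Proof.
move=> a0 b0; split=> [->//|/eqP].
by rewrite eqrXn2 // => /eqP.
Qed.

Lemma sqr_edist_focal {R : realType} (O f : 'rV[R]_2) :
  edist (O + f) (O - f) ^+ 2 = 4 * dot f f.
Proof. by rewrite sqr_edist /dot !big_ord_recl !big_ord0 !mxE; ring. Qed.

(** The equation for [O - f] comes first because rewriting would also match
    [O - f] against [O + f]. *)
Lemma sqr_edist_foci {R : realType} (O f x : 'rV[R]_2) :
  (edist (O - f) (O + x) ^+ 2 = dot x x + dot f f + 2 * dot x f) *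
  (edist (O + f) (O + x) ^+ 2 = dot x x + dot f f - 2 * dot x f).
Proof.
by split; rewrite !sqr_edist /dot !big_ord_recl !big_ord0 !mxE; ring.
Qed.

Lemma sqr_edist_prod {R : realType} (O f x : 'rV[R]_2) :
  (edist (O + f) (O + x) * edist (O - f) (O + x)) ^+ 2 =
  (dot x x + dot f f) ^+ 2 - 4 * dot x f ^+ 2.
Proof. by rewrite exprMn !sqr_edist_foci; ring. Qed.

Lemma lemniscateP {R : realType} (O f x : 'rV[R]_2) :
  lemniscate (O + f) (O - f) (O + x) <->
  dot x x ^+ 2 + 2 * dot f f * dot x x = 4 * dot x f ^+ 2.
Proof.
rewrite /lemniscate /= sqr_edist_focal mulKf ?pnatr_eq0 //.
rewrite eqr_sqr_ge0 ?mulr_ge0 ?edist_ge0 ?dot_ge0 // sqr_edist_prod.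
by split=> h; lra.
Qed.

(** With [d1], [d2] the distances to the foci, [(d1 - d2)^2 = 2 c] reads
    [d1 d2 = N], since [d1^2 + d2^2 = 2 N + 2 c]. *)
Lemma hyperbolaP {R : realType} (O f x : 'rV[R]_2) :
  equilateral_hyperbola (O + f) (O - f) (O + x) <->
  dot f f ^+ 2 + 2 * dot f f * dot x x = 4 * dot x f ^+ 2.
Proof.
have prodP : edist (O + f) (O + x) * edist (O - f) (O + x) = dot x x <->
    dot f f ^+ 2 + 2 * dot f f * dot x x = 4 * dot x f ^+ 2.
  rewrite eqr_sqr_ge0 ?mulr_ge0 ?edist_ge0 ?dot_ge0 // sqr_edist_prod.
  by split=> h; lra.
rewrite -prodP /equilateral_hyperbola /=.
rewrite eqr_sqr_ge0 ?divr_ge0 ?edist_ge0 ?sqrtr_ge0 ?normr_ge0 //.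
rewrite real_normK ?num_real // sqrrB expr_div_n (sqr_sqrtr (ler0n R 2)).
rewrite sqr_edist_focal !sqr_edist_foci.
by split=> h; lra.
Qed.

(** The ray condition leaves [y = t x] with [0 <= t]; the condition on the
    distances is then [t |x| = r^2 / |x|]. *)
Lemma inversionP {R : realType} (O : 'rV[R]_2) (r : R) (x y : 'rV[R]_2) :
  inversion O r (O + x) (O + y) <->
  x <> 0 /\ y = (r ^+ 2 / dot x x) *: x.
Proof.
have xO : (O + x = O) = (x = 0).
  by apply/propext; split=> [/(canRL (addKr O))|->]; rewrite ?addNr ?addr0.
rewrite /inversion /eray /= xO !edistO [O + x - O]addrC addKr.
split.
- move=> [x0 [t t0 /addrI <-] tE]; split=> //.
  have xx0 : 0 < dot x x by rewrite lt_def dot_ge0 dot_eq0 andbT; apply/eqP.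
  move: tE; rewrite dotZZ sqrtrM ?sqr_ge0 // sqrtr_sqr ger0_norm //.
  rewrite -{3}[dot x x]sqr_sqrtr ?dot_ge0 // => tE; congr (_ *: _).
  by rewrite expr2 invfM mulrA -tE mulfK // gt_eqF // sqrtr_gt0.
- move=> [x0 ->].
  have xx0 : 0 < dot x x by rewrite lt_def dot_ge0 dot_eq0 andbT; apply/eqP.
  have t0 : 0 <= r ^+ 2 / dot x x by rewrite divr_ge0 ?sqr_ge0 ?dot_ge0.
  split=> //; first by exists (r ^+ 2 / dot x x).
  rewrite dotZZ sqrtrM ?sqr_ge0 // sqrtr_sqr ger0_norm //.
  rewrite -{1}[dot x x]sqr_sqrtr ?dot_ge0 // expr2 invfM -!mulrA.
  by rewrite mulVf ?mulr1 // gt_eqF // sqrtr_gt0.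
Qed.

Lemma inversion_total {R : realType} (O : 'rV[R]_2) (r : R) (X : 'rV[R]_2) :
  X <> O -> exists Y, inversion O r X Y.
Proof.
move=> XO; exists (O + (r ^+ 2 / dot (X - O) (X - O)) *: (X - O)).
rewrite -{1}(subrKC O X); apply/inversionP; split=> //.
by move/eqP; rewrite subr_eq0 => /eqP.
Qed.

Lemma inversion_sym {R : realType} (O : 'rV[R]_2) (r : R) (X Y : 'rV[R]_2) :
  r != 0 -> inversion O r X Y -> inversion O r Y X.
Proof.
rewrite -(subrKC O X) -(subrKC O Y).
move: (X - O) (Y - O) => x y r0 /inversionP[/eqP x0 ->]; apply/inversionP.
have xx0 : dot x x != 0 by rewrite dot_eq0.
split.
  by apply/eqP; rewrite scaler_eq0 negb_or x0 mulf_neq0 ?invr_neq0 ?expf_neq0.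
rewrite dotZZ scalerA -[LHS]scale1r; congr (_ *: _); field.
by rewrite xx0 r0.
Qed.

Lemma lemniscate_inversion {R : realType} (O f X Y : 'rV[R]_2) :
    f != 0 -> inversion O (edist O (O + f)) X Y ->
  lemniscate (O + f) (O - f) Y <-> equilateral_hyperbola (O + f) (O - f) X.
Proof.
rewrite -(subrKC O X) -(subrKC O Y).
move: (X - O) (Y - O) => x y f0 /inversionP[/eqP x0].
rewrite edistO sqr_sqrtr ?dot_ge0 // => ->.
have xx0 : dot x x != 0 by rewrite dot_eq0.
have ff0 : dot f f != 0 by rewrite dot_eq0.
rewrite lemniscateP hyperbolaP dotZZ dotZl.
move: (dot x x) (dot f f) (dot x f) xx0 ff0 => N c p N0 c0.
have k0 : c ^+ 2 / N ^+ 2 != 0 by rewrite mulf_neq0 ?invr_neq0 ?expf_neq0.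
have -> : ((c / N) ^+ 2 * N) ^+ 2 + 2 * c * ((c / N) ^+ 2 * N) =
    c ^+ 2 / N ^+ 2 * (c ^+ 2 + 2 * c * N) by field.
have -> : 4 * (c / N * p) ^+ 2 = c ^+ 2 / N ^+ 2 * (4 * p ^+ 2) by field.
by split=> [/(mulfI k0)|->].
Qed.

Lemma emidpoint_foci {R : realType} (F1 F2 : 'rV[R]_2) :
  exists f, F1 = emidpoint F1 F2 + f /\ F2 = emidpoint F1 F2 - f.
Proof.
exists (2^-1 *: (F1 - F2)); rewrite /emidpoint.
by split; apply/rowP => i; rewrite !mxE; field.
Qed.

Theorem mainTheorem3 (R : realType) (F1 F2 O : 'rV[R]_2)
    (hF : F1 <> F2) (hO : O = emidpoint F1 F2) :
  [/\ ~ equilateral_hyperbola F1 F2 O,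
      rel_image (inversion O (edist O F1)) (equilateral_hyperbola F1 F2)
        = lemniscate F1 F2 `\ O
    & rel_image (ext_inversion O (edist O F1))
        (None |` (Some @` equilateral_hyperbola F1 F2))
        = Some @` lemniscate F1 F2 ].
Proof.
have [f] := emidpoint_foci F1 F2; rewrite -hO => -[F1E F2E].
have f0 : f != 0.
  by apply/eqP => f0; apply: hF; rewrite F1E F2E f0 oppr0.
have {hF hO F1 F2 F1E F2E} [-> ->] := (F1E, F2E).
have ff0 : dot f f != 0 by rewrite dot_eq0.
have r0 : edist O (O + f) != 0.
  by rewrite edistO gt_eqF // sqrtr_gt0 lt_def ff0 dot_ge0.
have dot0 (v : 'rV[R]_2) : dot 0 v = 0 by rewrite -(scale0r 0) dotZl mul0r.
have OnotinH : ~ equilateral_hyperbola (O + f) (O - f) O.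
  rewrite -{3}[O]addr0 hyperbolaP !dot0 expr0n !mulr0 addr0 => /eqP.
  by rewrite sqrf_eq0; apply/negP.
have OinL : lemniscate (O + f) (O - f) O.
  by rewrite -{3}[O]addr0; apply/lemniscateP; rewrite !dot0 expr0n !mulr0 addr0.
have image : rel_image (inversion O (edist O (O + f)))
    (equilateral_hyperbola (O + f) (O - f)) =
    lemniscate (O + f) (O - f) `\ O.
  apply/seteqP; split=> [Y [X HX XY]|Y [LY YO]].
    split; first exact/(lemniscate_inversion O f X Y f0 XY).
    by have [] := inversion_sym O _ X Y r0 XY.
  have [X YX] := inversion_total O (edist O (O + f)) Y YO.
  have XY := inversion_sym O _ Y X r0 YX.
  by exists X => //; apply/(lemniscate_inversion O f X Y f0 XY).
split=> //; apply/seteqP; split.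
- move=> [Y|] [_ [->|[X HX <-]]] //= XY.
  + by exists O; rewrite // XY.
  + have [LY _] : (lemniscate (O + f) (O - f) `\ O) Y.
      by rewrite -image; exists X.
    by exists Y.
  + by case: OnotinH; rewrite -{3}XY.
- move=> _ [Y LY <-]; have [->|YO] := pselect (Y = O).
    by exists None => //; left.
  have [X HX XY] : rel_image (inversion O (edist O (O + f)))
      (equilateral_hyperbola (O + f) (O - f)) Y by rewrite image; split.
  by exists (Some X) => //; right; exists X.
Qed.
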